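(* Let $n,\gamma,\beta$ be nonnegative integers with $\gamma+\beta\le n$, let $\tau>0$, and consider a linear lattice Boltzmann BGK scheme $$f_i(t+\Delta t,\mathbf x+\Delta t\,\mathbf c_i)=f_i(t,\mathbf x)+\frac1\tau\,\mathbf e_i^T\,(M^{(1)})^{-1}\left(E^{(1)}-I_n\right)M^{(1)}\,\mathbf f(t,\mathbf x),\qquad i=1,\dots,n,$$ with regular moment matrix $M^{(1)}\in\mathbb R^{n\times n}$ and equilibrium matrix $$E^{(1)}=\begin{pmatrix} I_\gamma&0&0\\ E^{(1)}_{21}&0&0\\ E^{(1)}_{31}&0&0\end{pmatrix}\in\mathbb R^{n\times n}$$ (block sizes $\gamma,\ \beta,\ n-\beta-\gamma$), which is consistent to $\alpha$-th order. Define $$E^{(3)}=\begin{pmatrix} I_\gamma&0&0\\0&0&0\\0&0&0\end{pmatrix},\qquad M^{(3)}=\begin{pmatrix} I_\gamma&0&0\\ -E^{(1)}_{21}&I_\beta&0\\ 0&0&I_{n-\beta-\gamma}\end{pmatrix}M^{(1)},$$ and let $\mathbf r^{(3)}_i$ denote the $i$-th row of $M^{(3)}$. Let $\Lambda^{(3)}\in\mathbb R^{n\times n}$ be diagonal and positive definite, write $\langle\boldsymbol\xi,\boldsymbol\zeta\rangle_{\Lambda^{(3)}}=\boldsymbol\xi\,\Lambda^{(3)}\boldsymbol\zeta^T$ for row vectors, and assume that the following (equivalent) conditions hold: $$\langle\mathbf r^{(3)}_i,\mathbf r^{(3)}_j\rangle_{\Lambda^{(3)}}=0\quad\text{for } i=1,\dots,\gamma,\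 j=\gamma+1,\dots,\beta+\gamma,$$ $$\operatorname{span}\{\mathbf r^{(3)}_i:\ i=\gamma+1,\dots,\beta+\gamma\}\subset\operatorname{span}\{\mathbf r^{(3)}_i:\ i=1,\dots,\gamma\}^{\perp_{\Lambda^{(3)}}},$$ where $\perp_{\Lambda^{(3)}}$ denotes the orthogonal complement with respect to $\langle\cdot,\cdot\rangle_{\Lambda^{(3)}}$. Let $\{\mathbf o^{(3)}_j: j=1,\dots,\gamma\}$ be a basis of $\operatorname{span}\{\mathbf r^{(3)}_i: i=1,\dots,\gamma\}$ that is orthogonal with respect to $\langle\cdot,\cdot\rangle_{\Lambda^{(3)}}$, and let $\tilde M^{(3)}$ be the matrix with rows $$\tilde{\mathbf r}^{(3)}_i=\begin{cases}\mathbf r^{(3)}_i,& i=1,\dots,\beta+\gamma,\\[1ex] \mathbf r^{(3)}_i-\displaystyle\sum_{j=1}^{\gamma}\frac{\langle\mathbf r^{(3)}_i,\mathbf o^{(3)}_j\rangle_{\Lambda^{(3)}}}{\langle\mathbf o^{(3)}_j,\mathbf o^{(3)}_j\rangle_{\Lambda^{(3)}}}\,\mathbf o^{(3)}_j,& i=\beta+\gamma+1,\dots,n.\end{cases}$$ Then the collision matrix $$\tilde J^{(3)}=\frac1\tau\,(\tilde M^{(3)})^{-1}\left(E^{(3)}-I_n\right)\tilde M^{(3)}$$ admits a pre-stability structure, and the lattice Boltzmann scheme $$f_i(t+\Delta t,\mathbf x+\Delta t\,\mathbf c_i)=f_i(t,\mathbf x)+\mathbf e_i^T\tilde J^{(3)}\mathbf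 f(t,\mathbf x),\qquad i=1,\dots,n,$$ is consistent to $\alpha$-th order. If in addition $\tau\in\left[\tfrac12,\infty\right)$, then $\tilde J^{(3)}$ admits a stability structure.
   Context: Setting. $\mathbf f(t,\mathbf x)=(f_1,\dots,f_n)^T\in\mathbb R^n$ is the vector of particle densities on a periodic equidistant lattice in $\mathbb R^D$ with spacing $\Delta t$; the time step is also $\Delta t$. The discrete velocities $\mathbf c_1,\dots,\mathbf c_n\in\mathbb R^D$ map lattice nodes to lattice nodes ($\mathbf x\mapsto\mathbf x+\Delta t\,\mathbf c_i$), and the velocity set is symmetric under $\mathbf c\mapsto-\mathbf c$. $\mathbf e_i$ is the $i$-th standard basis vector and $I_m$ the $m\times m$ identity. The moment matrix $M^{(1)}$ maps $\mathbf f$ to moments: its first $\gamma$ rows give the conserved moments, the next $\beta$ rows give the moments whose equilibrium values are prescribed by consistency, and the remaining rows make it regular. The equilibrium matrix maps moments to equilibrium moments; a scheme with moment matrix $M$ and equilibrium matrix $E$ has equilibrium $\mathbf f^{eq}=M^{-1}EM\mathbf f$. Pre-stability structure. A matrix $J\in\mathbb R^{n\times n}$ has (admits) a pre-stability structure $(P,\mathbf a,\mathbf s)$ if there exist an invertible $P\in\mathbb R^{n\times n}$ and vectors $\mathbf s=(s_1,\dots,s_n)^T$, $\mathbf a=(a_1,\dots,a_n)^T\in\mathbb R^n$ such that $PJ=-\operatorname{diag}(s_1,\dots,s_n)P$ and $P^TP=\operatorname{diag}(a_1,\dots,a_n)$. It is a stability structure if moreover $s_k\in[0,2]$ for all $k$.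 Consistency. A scheme is consistent to $\alpha$-th order with a given linear system of partial differential equations for its conserved moments if, for formal expansions $\mathbf f=\sum_{k\ge0}\Delta t^k\mathbf f^{(k)}$ (smooth coefficients) inserted in the scheme, Taylor expanded about $(t,\mathbf x)$ and sorted by powers of $\Delta t$, the conserved moments of $\mathbf f^{(0)},\dots,\mathbf f^{(\alpha-1)}$ each satisfy that system. Both schemes are considered with the same target system. Standing assumption on the choice of the $\beta$ prescribed moments: the order of consistency is determined by the first $\beta+\gamma$ equilibrium moments only. That is, if another linear BGK scheme with the same velocities and the same $\tau$ has an equilibrium map $\mathbf f\mapsto\mathbf f^{eq}$ for which the first $\beta+\gamma$ entries of $M^{(1)}\mathbf f^{eq}$ are the same functions of $\mathbf f$ as for the original scheme, then it has the same order of consistency; the remaining equilibrium moments influence only the error term, not its order. *)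

(* Defs.v *)
From mathcomp Require Import all_boot all_order all_algebra.
From mathcomp Require Import all_classical all_reals all_analysis.

Set Implicit Arguments.
Unset Strict Implicit.
Unset Printing Implicit Defensive.

Import Order.TTheory GRing.Theory Num.Theory.
Import numFieldNormedType.Exports.

Local Open Scope ring_scope.

Section Fields.
Context {R : realType} {D : nat}.

(* A point (t, x) is the row vector with entry 0 equal to t, followed by the
   D entries of x.  Fields are only constrained at positive times. *)
Definition spacetime := 'rV[R]_(1 + D).

Definition time (z : spacetime) : R := lsubmx z 0 0.

Definition dirderivs (s : seq spacetime) (g : spacetime -> R) :=
  foldr (fun (v : spacetime) (h : spacetime -> R) => 'D_v h) g s.

Definition partial (s : seq 'I_(1 + D)) (g : spacetime -> R) :=
  dirderivs [seq delta_mx 0 l | l <- s] g.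

Definition smooth (g : spacetime -> R) : Prop :=
  forall (s : seq spacetime) (z : spacetime),
    0 < time z -> differentiable (dirderivs s g) z.

Definition space_periodic (L : 'I_D -> R) (g : spacetime -> R) : Prop :=
  forall (l : 'I_D) (z : spacetime),
    0 < time z -> g (z + L l *: delta_mx 0 (rshift 1 l)) = g z.

(* d/dt + v . nabla *)
Definition transport (v : 'rV[R]_D) (g : spacetime -> R) : spacetime -> R :=
  'D_(row_mx (const_mx 1) v : spacetime) g.

(* The coefficient of dt^k in the formal Taylor expansion about z = (t, x) of
   sum_k dt^k g_k (t + dt, x + dt v). *)
Definition shift_coef (v : 'rV[R]_D) (g : nat -> spacetime -> R) (k : nat)
    (z : spacetime) : R :=
  \sum_(m < k.+1) (m`!)%:R^-1 * iter m (transport v) (g (k - m)%N) z.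

(* A linear equation
     sum over the terms of  coef(z) * (partial derivative of u_comp)(z)
       = source(z)
   for unknowns u_0, ..., u_(g-1); term_deriv lists the coordinates with
   respect to which u_comp is differentiated (0 is time). *)
Record pde_term (g : nat) := PDETerm {
  term_coef : spacetime -> R;
  term_deriv : seq 'I_(1 + D);
  term_comp : 'I_g }.

Record linear_pde (g : nat) := LinearPDE {
  pde_terms : seq (pde_term g);
  pde_source : spacetime -> R }.

Definition satisfies (g q : nat) (pde : 'I_q -> linear_pde g)
    (u : 'I_g -> spacetime -> R) : Prop :=
  forall (e : 'I_q) (z : spacetime), 0 < time z ->
    \sum_(a <- pde_terms (pde e))
       term_coef a z * partial (term_deriv a) (u (term_comp a)) z
    = pde_source (pde e) z.

End Fields.

Arguments spacetime : clear implicits.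
Arguments linear_pde : clear implicits.

Section Schemes.
Context {R : realType}.

(* Coefficients f^(k) of a formal expansion sum_k dt^k f^(k) that solves
     f_i(t + dt, x + dt c_i) = f_i(t, x) + e_i^T J f(t, x)
   at every order in dt, on a spatially periodic domain. *)
Definition formal_solution (D n : nat) (c : 'I_n -> 'rV[R]_D) (L : 'I_D -> R)
    (J : 'M[R]_n) (f : nat -> spacetime R D -> 'cV[R]_n) : Prop :=
  [/\ forall k i, smooth (fun z => f k z i 0),
      forall k i, space_periodic L (fun z => f k z i 0) &
      forall k i z, 0 < time z ->
        shift_coef (c i) (fun l y => f l y i 0) k z
        = f k z i 0 + (J *m f k z) i 0].

(* The rows of C give the conserved moments. *)
Definition consistent (D n g q : nat) (c : 'I_n -> 'rV[R]_D) (L : 'I_D -> R)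
    (pde : 'I_q -> linear_pde R D g) (C : 'M[R]_(g, n)) (J : 'M[R]_n)
    (order : nat) : Prop :=
  forall f, formal_solution c L J f ->
  forall k, (k < order)%N -> satisfies pde (fun j z => (C *m f k z) j 0).

Definition bgk_collision (n : nat) (tau : R) (M E : 'M[R]_n) : 'M[R]_n :=
  tau^-1 *: (invmx M *m (E - 1%:M) *m M).

Definition bgk_equilibrium (n : nat) (M E : 'M[R]_n) (f : 'cV[R]_n) :
    'cV[R]_n :=
  invmx M *m E *m M *m f.

Definition conserved_rows (g m : nat) (M : 'M[R]_(g + m)) : 'M[R]_(g, g + m) :=
  usubmx M.

(* The order of consistency of the scheme (M, E) is unaffected by replacing its
   equilibrium with any other linear one having the same first p moments.  The
   target system still refers to the first g moments of M, which the other
   scheme also conserves whenever g <= p and (M, E) conserves them. *)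
Definition order_determined_by (D g m q : nat)
    (c : 'I_(g + m) -> 'rV[R]_D) (L : 'I_D -> R)
    (pde : 'I_q -> linear_pde R D g) (tau : R) (M E : 'M[R]_(g + m))
    (p order : nat) : Prop :=
  forall M' E' : 'M[R]_(g + m), M' \in unitmx ->
    (forall (f : 'cV[R]_(g + m)) (i : 'I_(g + m)), (i < p)%N ->
       (M *m bgk_equilibrium M' E' f) i 0 = (M *m bgk_equilibrium M E f) i 0) ->
    consistent c L pde (conserved_rows M) (bgk_collision tau M' E') order <->
    consistent c L pde (conserved_rows M) (bgk_collision tau M E) order.

Definition prestability_structure (n : nat) (J P : 'M[R]_n)
    (a s : 'rV[R]_n) : Prop :=
  [/\ P \in unitmx, P *m J = - diag_mx s *m P & P^T *m P = diag_mx a].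

Definition stability_structure (n : nat) (J P : 'M[R]_n)
    (a s : 'rV[R]_n) : Prop :=
  prestability_structure J P a s /\ forall k, 0 <= s 0 k <= 2.

Definition admits_prestability (n : nat) (J : 'M[R]_n) : Prop :=
  exists P a s, prestability_structure J P a s.

Definition admits_stability (n : nat) (J : 'M[R]_n) : Prop :=
  exists P a s, stability_structure J P a s.

Definition wdot (n : nat) (Lam : 'M[R]_n) (u v : 'rV[R]_n) : R :=
  (u *m Lam *m v^T) 0 0.

Definition posdef (n : nat) (Lam : 'M[R]_n) : Prop :=
  forall v : 'rV[R]_n, v != 0 -> 0 < wdot Lam v v.

End Schemes.

(* The number of velocities is n = g + (b + d), so that d = n - b - g. *)
Section Transformation.
Context {R : realType} {g b d : nat}.
Notation n := (g + (b + d))%N.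

Definition block3_mx
    (A11 : 'M[R]_(g, g)) (A12 : 'M[R]_(g, b)) (A13 : 'M[R]_(g, d))
    (A21 : 'M[R]_(b, g)) (A22 : 'M[R]_(b, b)) (A23 : 'M[R]_(b, d))
    (A31 : 'M[R]_(d, g)) (A32 : 'M[R]_(d, b)) (A33 : 'M[R]_(d, d)) : 'M[R]_n :=
  block_mx A11 (row_mx A12 A13)
           (col_mx A21 A31) (block_mx A22 A23 A32 A33).

Definition E1_mx (E21 : 'M[R]_(b, g)) (E31 : 'M[R]_(d, g)) : 'M[R]_n :=
  block3_mx 1%:M 0 0
            E21  0 0
            E31  0 0.

Definition E3_mx : 'M[R]_n :=
  block3_mx 1%:M 0 0
            0    0 0
            0    0 0.

Definition M3_mx (E21 : 'M[R]_(b, g)) (M1 : 'M[R]_n) : 'M[R]_n :=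
  block3_mx 1%:M    0    0
            (- E21) 1%:M 0
            0       0    1%:M *m M1.

Definition prescribed_rows (M : 'M[R]_n) : 'M[R]_(b, n) := usubmx (dsubmx M).
Definition free_rows (M : 'M[R]_n) : 'M[R]_(d, n) := dsubmx (dsubmx M).

(* The rows of O are the vectors o_j. *)
Definition orthogonalized (Lam M : 'M[R]_n) (O : 'M[R]_(g, n)) : 'M[R]_n :=
  col_mx (conserved_rows M)
    (col_mx (prescribed_rows M)
       (\matrix_(i < d)
          (row i (free_rows M)
           - \sum_(j < g)
               (wdot Lam (row i (free_rows M)) (row j O)
                / wdot Lam (row j O) (row j O)) *: row j O))).

End Transformation.

Arguments E3_mx : clear implicits.

(* Main.v *)
Require Import Defs.
From mathcomp Require Import all_boot all_order all_algebra.
From mathcomp Require Import all_classical all_reals all_analysis.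
Import Order.TTheory GRing.Theory Num.Theory.
Import numFieldNormedType.Exports.
Local Open Scope ring_scope.

(* Orthogonalization only changes M1 by a block unitriangular factor N = T M1,
   and it makes the conserved rows of N Lam-orthogonal to all its other rows.
   Hence N Lam N^T = diag(G, H) with G and H positive definite.  Choosing A1, A2
   with A1 G A1^T = 1 and A2 H A2^T = 1, the matrix P = diag(A1, A2) N satisfies
   P Lam P^T = 1, that is P^T P = Lam^-1, which is diagonal.  As E3 - 1 commutes
   with diag(A1, A2), P diagonalizes the collision matrix, with s = 0 on the
   conserved moments and s = 1/tau elsewhere.
   Consistency is inherited because the equilibrium f^eq of (N, E3) satisfies
   C f^eq = C f and (B - E21 C) f^eq = 0, where C and B are the conserved and
   prescribed rows of M1; so its first b + g moments are those of (M1, E1). *)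

(** * Congruence of positive definite matrices *)

Lemma scaled_sqr_inv {R : realType} (a : R) :
  0 < a -> (Num.sqrt a)^-1 * a * (Num.sqrt a)^-1 = 1.
Proof.
move=> a_gt0; rewrite mulrAC -expr2 exprVn sqr_sqrtr ?ltW // mulVf //.
by rewrite gt_eqF.
Qed.

Lemma wdot_congr {R : realType} {m n : nat} (N : 'M[R]_(m, n)) (G : 'M[R]_n)
    (u v : 'rV[R]_m) :
  wdot (N *m G *m N^T) u v = wdot G (u *m N) (v *m N).
Proof. by rewrite /wdot trmx_mul !mulmxA. Qed.

Lemma posdef_congr {R : realType} {m n : nat} (N : 'M[R]_(m, n))
    (G : 'M[R]_n) :
  row_free N -> posdef G -> posdef (N *m G *m N^T).
Proof.
move=> N_free G_pos u u_neq0; rewrite wdot_congr; apply: G_pos.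
by rewrite mulmx_free_eq0.
Qed.

Lemma row_free_id0 {R : realType} (m n : nat) :
  row_free (row_mx 1%:M 0 : 'M[R]_(m, m + n)).
Proof.
apply/row_freeP; exists (col_mx 1%:M 0).
by rewrite mul_row_col mul1mx mul0mx addr0.
Qed.

Lemma row_free_0id {R : realType} (m n : nat) :
  row_free (row_mx 0 1%:M : 'M[R]_(n, m + n)).
Proof.
apply/row_freeP; exists (col_mx 0 1%:M).
by rewrite mul_row_col mul1mx mul0mx add0r.
Qed.

(** Each diagonal block is the congruence of the whole matrix by a coordinate projection, which is
    row free. *)
Lemma posdef_block_diag {R : realType} {m n : nat} (G : 'M[R]_m)
    (H : 'M[R]_n) :
  posdef (block_mx G 0 0 H) -> posdef G /\ posdef H.
Proof.
move=> GH_pos; split.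
- have := posdef_congr _ _ (row_free_id0 m n) GH_pos.
  rewrite tr_row_mx mul_row_block mul_row_col trmx1 trmx0.
  by rewrite !(mul0mx, mulmx0, mul1mx, mulmx1) !addr0.
- have := posdef_congr _ _ (row_free_0id m n) GH_pos.
  rewrite tr_row_mx mul_row_block mul_row_col trmx1 trmx0.
  by rewrite !(mul0mx, mulmx0, mul1mx, mulmx1) !add0r.
Qed.

(** Cholesky reduction by induction on the size: clear the first row and column with the pivot,
    recurse on the Schur complement, which is again symmetric and positive definite, and rescale the
    pivot to 1. *)
Lemma posdef_congr_id {R : realType} {n : nat} (G : 'M[R]_n) :
  G^T = G -> posdef G -> exists A : 'M[R]_n, A *m G *m A^T = 1%:M.
Proof.
elim: n G => [|n IHn] G.
  by exists 0; apply/matrixP => - [].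
rewrite -[n.+1]/(1 + n)%N in G *; move=> G_sym G_pos.
set a := ulsubmx G 0 0.
have ulE : ulsubmx G = a%:M by exact: mx11_scalar.
have a_gt0 : 0 < a.
  (* The pivot [a] is the value of the form at the first basis vector. *)
  have := posdef_congr _ _ (row_free_id0 1 n) G_pos 1%:M (oner_neq0 _).
  rewrite wdot_congr /wdot mul1mx -{1}(submxK G) mul_row_block tr_row_mx.
  by rewrite mul_row_col trmx1 trmx0 !(mul0mx, mulmx0, mul1mx, mulmx1) !addr0.
set w := dlsubmx G.
have urE : ursubmx G = w^T by rewrite /w trmx_dlsub G_sym.
(* [T] is the elimination step below the pivot, and [S] is the Schur complement that it leaves. *)
pose T : 'M[R]_(1 + n) := block_mx 1%:M 0 (- a^-1 *: w) 1%:M.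
pose S := drsubmx G - a^-1 *: (w *m w^T).
have TGT : T *m G *m T^T = block_mx a%:M 0 0 S.
  rewrite -(submxK G) ulE urE -/w /T tr_block_mx !mulmx_block.
  rewrite !(trmx1, trmx0, mul0mx, mulmx0, mul1mx, mulmx1, addr0, add0r).
  have -> : - a^-1 *: w *m a%:M + w = 0.
    by rewrite mul_mx_scalar scalerA mulrN divff ?gt_eqF // scaleN1r addNr.
  rewrite mul0mx add0r linearZ /= mul_scalar_mx scalerA mulrN divff ?gt_eqF //.
  by rewrite scaleN1r addNr -scalemxAl scaleNr addrC.
have T_free : row_free T.
  by rewrite row_free_unit unitmxE det_lblock !det1 mulr1 unitr1.
have := posdef_congr _ _ T_free G_pos.
rewrite TGT => /posdef_block_diag[_ S_pos].
have S_sym : S^T = S.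
  by rewrite /S linearB linearZ /= trmx_mul trmxK trmx_drsub G_sym.
have [A AS] := IHn S S_sym S_pos.
exists (block_mx (Num.sqrt a)^-1%:M 0 0 A *m T).
rewrite trmx_mul -!mulmxA (mulmxA G) (mulmxA T) (mulmxA T) TGT.
rewrite tr_block_mx !mulmx_block !(trmx0, mul0mx, mulmx0, addr0, add0r).
rewrite tr_scalar_mx -!scalar_mxM !mulrA scaled_sqr_inv // mulmxA AS.
by rewrite -scalar_mx_block.
Qed.

(** * Pre-stability from block orthogonality of the moment matrix *)

Lemma bgk_prestability {R : realType} {g m : nat} (tau : R)
    (N Lam : 'M[R]_(g + m)) :
  is_diag_mx Lam -> posdef Lam -> N \in unitmx ->
  usubmx N *m Lam *m (dsubmx N)^T = 0 ->
  exists P a, prestability_structure (bgk_collision tau N (block_mx 1%:M 0 0 0))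
    P a (row_mx 0 (const_mx tau^-1)).
Proof.
move=> /diag_mxP[l LamE] Lam_pos N_unit orth.
have Lam_sym : Lam^T = Lam by rewrite LamE tr_diag_mx.
have orth' : dsubmx N *m Lam *m (usubmx N)^T = 0.
  by apply: trmx_inj; rewrite trmx0 -orth !trmx_mul trmxK Lam_sym mulmxA.
set G := usubmx N *m Lam *m (usubmx N)^T.
set H := dsubmx N *m Lam *m (dsubmx N)^T.
have NLN : N *m Lam *m N^T = block_mx G 0 0 H.
  rewrite -{1 2}(vsubmxK N) tr_col_mx mul_col_mx mul_col_row.
  by rewrite orth orth'.
have NLN_pos : posdef (N *m Lam *m N^T).
  by apply: posdef_congr => //; rewrite row_free_unit.
have [G_pos H_pos] : posdef G /\ posdef H.
  by apply: posdef_block_diag; rewrite -NLN.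
have gram_sym k (B : 'M[R]_(k, g + m)) : (B *m Lam *m B^T)^T = B *m Lam *m B^T.
  by rewrite !trmx_mul trmxK Lam_sym mulmxA.
have [A1 A1G] := posdef_congr_id G (gram_sym _ _) G_pos.
have [A2 A2H] := posdef_congr_id H (gram_sym _ _) H_pos.
clearbody G H.
set A : 'M[R]_(g + m) := block_mx A1 0 0 A2.
have PLP : A *m N *m Lam *m (A *m N)^T = 1%:M.
  rewrite trmx_mul -!mulmxA (mulmxA N) (mulmxA (N *m Lam)) NLN.
  rewrite tr_block_mx !mulmx_block !(trmx0, mul0mx, mulmx0, addr0, add0r).
  by rewrite !mulmxA A1G A2H -scalar_mx_block.
(* By [PLP], [Lam *m (A *m N)^T] is a right inverse of the square matrix [A *m N], hence also a left
   inverse. *)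
have PTP : Lam *m ((A *m N)^T *m (A *m N)) = 1%:M.
  by rewrite mulmxA; apply: mulmx1C; rewrite mulmxA.
have l_neq0 i : l 0 i != 0.
  have := Lam_pos (delta_mx 0 i) _; rewrite /wdot LamE.
  rewrite -rowE row_diag_mx -scalemxAl trmx_delta mul_delta_mx !mxE !eqxx mulr1.
  move=> l_gt0; rewrite gt_eqF // l_gt0 //.
  apply/eqP => /matrixP/(_ 0 i); rewrite !mxE !eqxx => /eqP.
  by rewrite oner_eq0.
exists (A *m N), (\row_i (l 0 i)^-1); split.
- by case: (mulmx1_unit PLP) => _; rewrite unitmx_tr.
- rewrite /bgk_collision -scalemxAr !mulmxA mulmxK //.
  rewrite (scalar_mx_block g m 1) opp_block_mx add_block_mx !subrr add0r.
  rewrite diag_mx_row linear0 diag_const_mx opp_block_mx !mulmx_block.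
  rewrite !(linear0, oppr0, mul0mx, mulmx0, addr0, add0r).
  rewrite mulmxN mulmx1 mulNmx mul_scalar_mx -scalerN.
  by rewrite scalemxAl scale_block_mx !scaler0.
- rewrite -[LHS]mul1mx.
  have <- : diag_mx (\row_i (l 0 i)^-1) *m Lam = 1%:M.
    rewrite LamE mulmx_diag -diag_const_mx; congr diag_mx.
    by apply/rowP => i; rewrite !mxE mulVf.
  by rewrite -mulmxA PTP mulmx1.
Qed.

(** * Orthogonalization in matrix form *)

Lemma wdot_rows {R : realType} {p q n : nat} (Lam : 'M[R]_n)
    (A : 'M[R]_(p, n)) (B : 'M[R]_(q, n)) (i : 'I_p) (j : 'I_q) :
  wdot Lam (row i A) (row j B) = (A *m Lam *m B^T) i j.
Proof.
by rewrite /wdot -row_mul !mxE; apply: eq_bigr => l _; rewrite !mxE.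
Qed.

(** Gram-Schmidt: in the pairing with row [j] of [O], orthogonality leaves only the [j]-th
    projection term, and its denominator cancels because row [j] is nonzero. *)
Lemma wdot_residual {R : realType} {p k n : nat} (Lam : 'M[R]_n)
    (O : 'M[R]_(k, n)) (F : 'M[R]_(p, n)) :
  posdef Lam -> row_free O ->
  (forall i j : 'I_k, i != j -> wdot Lam (row i O) (row j O) = 0) ->
  (F - (\matrix_(i, j) (wdot Lam (row i F) (row j O)
                         / wdot Lam (row j O) (row j O))) *m O)
    *m Lam *m O^T = 0.
Proof.
move=> Lam_pos O_free O_orth; apply/matrixP => i j.
rewrite -wdot_rows.
set K := \matrix_(_, _) _.
have O_neq0 : wdot Lam (row j O) (row j O) != 0.
  rewrite gt_eqF // Lam_pos // rowE mulmx_free_eq0 //.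
  apply/eqP => /matrixP/(_ 0 j); rewrite !mxE !eqxx => /eqP.
  by rewrite oner_eq0.
rewrite wdot_rows !mulmxBl -!(mulmxA K) mxE [X in _ + X]mxE [X in - X]mxE.
rewrite -wdot_rows.
rewrite (bigD1 j) //= big1 => [|l l_neq_j].
  rewrite addr0 -wdot_rows [K i j]mxE [RHS]mxE.
  by rewrite divfK // subrr.
by rewrite -wdot_rows O_orth ?mulr0.
Qed.

Lemma conserved_rows_M3 {R : realType} {g b d : nat} (E21 : 'M[R]_(b, g))
    (M1 : 'M[R]_(g + (b + d))) :
  conserved_rows (M3_mx E21 M1) = conserved_rows M1.
Proof.
rewrite /conserved_rows /M3_mx /block3_mx -{1}(vsubmxK M1) mul_block_col.
by rewrite col_mxKu row_mx0 mul0mx mul1mx addr0.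
Qed.

Lemma dsubmx_M3 {R : realType} {g b d : nat} (E21 : 'M[R]_(b, g))
    (M1 : 'M[R]_(g + (b + d))) :
  dsubmx (M3_mx E21 M1) =
  col_mx (prescribed_rows M1 - E21 *m conserved_rows M1) (free_rows M1).
Proof.
rewrite /M3_mx /block3_mx -{1}(vsubmxK M1) mul_block_col col_mxKd.
rewrite -scalar_mx_block mul1mx mul_col_mx -{1}(vsubmxK (dsubmx M1)).
by rewrite add_col_mx mul0mx add0r mulNmx addrC.
Qed.

Lemma orthogonalizedE {R : realType} {g b d : nat} (E21 : 'M[R]_(b, g))
    (M1 Lam : 'M[R]_(g + (b + d))) (O : 'M[R]_(g, g + (b + d))) :
  orthogonalized Lam (M3_mx E21 M1) O =
  col_mx (conserved_rows M1)
    (col_mx (prescribed_rows M1 - E21 *m conserved_rows M1)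
       (free_rows M1
        - (\matrix_(i, j) (wdot Lam (row i (free_rows M1)) (row j O)
                           / wdot Lam (row j O) (row j O))) *m O)).
Proof.
rewrite /orthogonalized conserved_rows_M3 /prescribed_rows /free_rows.
rewrite dsubmx_M3 col_mxKu col_mxKd; congr (col_mx _ (col_mx _ _)).
apply/row_matrixP => i; rewrite rowK linearB /= row_mul mulmx_sum_row.
by congr (_ - _); apply: eq_bigr => j _; rewrite !mxE.
Qed.

(** Subtracting combinations of conserved rows from the others is left multiplication by a block
    unitriangular matrix. Here [K1] will be [E21], and [K2] will be the projection coefficients
    rewritten in the conserved rows. *)
Lemma unitmx_sub_conserved {R : realType} {g b d : nat}
    (M : 'M[R]_(g + (b + d))) (K1 : 'M[R]_(b, g)) (K2 : 'M[R]_(d, g)) :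
  M \in unitmx ->
  col_mx (conserved_rows M)
    (col_mx (prescribed_rows M - K1 *m conserved_rows M)
       (free_rows M - K2 *m conserved_rows M)) \in unitmx.
Proof.
move=> M_unit.
have -> : col_mx (conserved_rows M)
    (col_mx (prescribed_rows M - K1 *m conserved_rows M)
       (free_rows M - K2 *m conserved_rows M))
    = block_mx 1%:M 0 (- col_mx K1 K2) 1%:M *m M.
  rewrite -[in RHS](vsubmxK M) mul_block_col !mul1mx mul0mx addr0.
  rewrite mulNmx mul_col_mx.
  by rewrite -[in RHS](vsubmxK (dsubmx M)) opp_col_mx add_col_mx !(addrC (- _)).
by rewrite unitmx_mul M_unit unitmxE det_lblock !det1 mulr1 unitr1.
Qed.

(** * Equilibrium moments of the two schemes *)

Lemma E3_mxE (R : realType) (g b d : nat) :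
  E3_mx R g b d = block_mx 1%:M 0 0 0.
Proof. by rewrite /E3_mx /block3_mx row_mx0 col_mx0 block_mx0. Qed.

Lemma E1_mx_moments {R : realType} {g b d : nat} (E21 : 'M[R]_(b, g))
    (E31 : 'M[R]_(d, g)) (M : 'M[R]_(g + (b + d))) :
  E1_mx E21 E31 *m M =
  col_mx (conserved_rows M)
    (col_mx (E21 *m conserved_rows M) (E31 *m conserved_rows M)).
Proof.
rewrite /E1_mx /block3_mx row_mx0 block_mx0 -{1}(vsubmxK M) mul_block_col.
by rewrite !mul0mx mul1mx !addr0 mul_col_mx.
Qed.

(** Right multiplication by [X] fixes the conserved rows of [N] and annihilates its other rows. With
    [C] and [B] the conserved and prescribed rows of [M1], this gives
    [B *m X = E21 *m C *m X = E21 *m C]. *)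
Lemma E3_equilibrium_moments {R : realType} {g b d : nat} (E21 : 'M[R]_(b, g))
    (M1 N : 'M[R]_(g + (b + d))) :
  N \in unitmx -> usubmx N = conserved_rows M1 ->
  usubmx (dsubmx N) = prescribed_rows M1 - E21 *m conserved_rows M1 ->
  let X := invmx N *m E3_mx R g b d *m N in
  M1 *m X =
  col_mx (conserved_rows M1)
    (col_mx (E21 *m conserved_rows M1) (free_rows M1 *m X)).
Proof.
move=> N_unit NC NB X.
have NX : N *m X = col_mx (usubmx N) 0.
  rewrite /X !mulmxA mulmxV // mul1mx E3_mxE -{1}(vsubmxK N) mul_block_col.
  by rewrite !mul0mx mul1mx !addr0.
have CX : conserved_rows M1 *m X = conserved_rows M1.
  by rewrite -NC mul_usub_mx NX col_mxKu.
have BX : prescribed_rows M1 *m X = E21 *m conserved_rows M1.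
  apply/eqP; rewrite -subr_eq0 -CX mulmxA -mulmxBl -NB.
  by rewrite !(mul_usub_mx, mul_dsub_mx) NX col_mxKd linear0.
rewrite -{1}(vsubmxK M1) -{1}(vsubmxK (dsubmx M1)) !mul_col_mx.
rewrite -[usubmx M1]/(conserved_rows M1) CX.
by rewrite -[usubmx (dsubmx M1)]/(prescribed_rows M1) BX.
Qed.

Theorem theorem8 (R : realType) (D g b d q : nat)
  (c : 'I_(g + (b + d)) -> 'rV[R]_D) (L : 'I_D -> R)
  (pde : 'I_q -> linear_pde R D g) (alpha : nat) (tau : R)
  (M1 : 'M[R]_(g + (b + d))) (E21 : 'M[R]_(b, g)) (E31 : 'M[R]_(d, g))
  (Lam : 'M[R]_(g + (b + d)))
  (L_gt0 : forall l, 0 < L l)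
  (c_lattice : forall i l, c i 0 l \is a Num.int)
  (c_sym : forall i, exists j, c j = - c i)
  (tau_gt0 : 0 < tau)
  (M1_regular : M1 \in unitmx)
  (M1_consistent : consistent c L pde (conserved_rows M1)
     (bgk_collision tau M1 (E1_mx E21 E31)) alpha)
  (M1_prescribed : order_determined_by c L pde tau M1 (E1_mx E21 E31)
     (b + g) alpha)
  (Lam_diag : is_diag_mx Lam)
  (Lam_posdef : posdef Lam) :
  let M3 := M3_mx E21 M1 in
  let rows_orthogonal := forall (i : 'I_g) (j : 'I_b),
    wdot Lam (row i (conserved_rows M3)) (row j (prescribed_rows M3)) = 0 in
  let span_orthogonal :=
    (prescribed_rows M3 <= orthomx idfun Lam (conserved_rows M3))%MS in
  (rows_orthogonal <-> span_orthogonal) /\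
  (rows_orthogonal ->
   forall O : 'M[R]_(g, g + (b + d)),
     row_free O -> (O == conserved_rows M3)%MS ->
     (forall i j : 'I_g, i != j -> wdot Lam (row i O) (row j O) = 0) ->
   let Mt := orthogonalized Lam M3 O in
   let Jt := bgk_collision tau Mt (E3_mx R g b d) in
   [/\ Mt \in unitmx,
       admits_prestability Jt,
       consistent c L pde (conserved_rows Mt) Jt alpha &
       2^-1 <= tau -> admits_stability Jt]).
Proof.
move=> M3 rows_orthogonal span_orthogonal.
have Lam_sym : Lam^T = Lam.
  by case/diag_mxP: Lam_diag => l ->; rewrite tr_diag_mx.
have MC : conserved_rows M3 = conserved_rows M1 by exact: conserved_rows_M3.
(* Both conditions say that one Gram block vanishes. It is taken in this transposed form because
   [orthomx] is the kernel of [Lam *m (conserved_rows M3)^T]. *)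
have rowsP : rows_orthogonal <->
    prescribed_rows M3 *m Lam *m (conserved_rows M3)^T = 0.
  have -> : prescribed_rows M3 *m Lam *m (conserved_rows M3)^T =
      (conserved_rows M3 *m Lam *m (prescribed_rows M3)^T)^T.
    by rewrite !trmx_mul trmxK Lam_sym mulmxA.
  split=> [orth | /(canRL trmxK) orth i j].
    by apply/matrixP => j i; rewrite mxE -wdot_rows orth mxE.
  by rewrite wdot_rows orth !mxE.
split.
  rewrite rowsP /span_orthogonal /orthomx map_mx_id //.
  by rewrite (sameP sub_kermxP eqP) mulmxA; split=> /eqP.
move=> /rowsP orthB O O_free /andP[OC CO] O_orth Mt Jt.
rewrite MC in orthB OC CO.
(* [OE] turns the subtracted projections into combinations of conserved rows, for invertibility;
   [CE] carries orthogonality to [O] over to the conserved rows. *)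
have [Q OE] := submxP OC; have [Q' CE] := submxP CO.
have MtE := orthogonalizedE E21 M1 Lam O; rewrite -/M3 -/Mt in MtE.
have Mt_unit : Mt \in unitmx.
  by rewrite MtE {4}OE mulmxA; apply: unitmx_sub_conserved.
have Mt_orth : usubmx Mt *m Lam *m (dsubmx Mt)^T = 0.
  apply: trmx_inj; rewrite trmx0 !trmx_mul trmxK Lam_sym mulmxA MtE.
  rewrite col_mxKu col_mxKd !mul_col_mx.
  have -> : prescribed_rows M1 - E21 *m conserved_rows M1 = prescribed_rows M3.
    by rewrite [RHS]/prescribed_rows dsubmx_M3 col_mxKu.
  rewrite orthB {1}CE trmx_mul mulmxA wdot_residual // mul0mx.
  by rewrite col_mx0.
have [P [a struct]] :=
  bgk_prestability tau Mt Lam Lam_diag Lam_posdef Mt_unit Mt_orth.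
rewrite -E3_mxE -/Jt in struct.
split=> //.
- by exists P, a, (row_mx 0 (const_mx tau^-1)).
- have -> : conserved_rows Mt = conserved_rows M1.
    by rewrite MtE /conserved_rows col_mxKu.
  apply/(M1_prescribed Mt (E3_mx R g b d) Mt_unit _) => // f i i_lt.
  rewrite /bgk_equilibrium !mulmxA mulmxV // mul1mx.
  rewrite E1_mx_moments -!mulmxA (mulmxA (invmx _)) (mulmxA (_ *m _)).
  rewrite (mulmxA M1) (E3_equilibrium_moments E21) //.
  + rewrite !mul_col_mx; case: (split_ordP i) => [j -> | j ij].
      by rewrite !col_mxEu.
    rewrite ij !col_mxEd; case: (split_ordP j) => [k -> | k jk].
      by rewrite !col_mxEu.
    (* A free moment has index at least [g + b], against [i_lt]. *)
    by move: i_lt; rewrite ij jk /= addnA (addnC b) ltnNge leq_addr.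
  + by rewrite MtE col_mxKu.
  + by rewrite MtE col_mxKd col_mxKu.
(* The same structure serves: its rates are 0 and [tau^-1], and [tau^-1 <= 2] is the bound
   [2^-1 <= tau] inverted. *)
- move=> tau_ge; exists P, a, (row_mx 0 (const_mx tau^-1)); split=> // k.
  rewrite mxE; case: splitP => j _; rewrite mxE ?lexx ?ler0n //.
  by rewrite invr_ge0 ltW //= invf_ple ?posrE.
Qed.
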